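(* Let $V_{\mathbf s}=(s_i^{j})_{i,j=0}^{n-1}$ be a nonsingular $n\times n$ Vandermonde matrix with complex knots $s_0,\dots,s_{n-1}$. Fix a complex scalar $f$ such that $|f|=1$ and $s_i\neq f\omega_n^j$ for all pairs $i,j\in\{0,\dots,n-1\}$, where $\omega_n=\exp(2\pi\sqrt{-1}/n)$, so that the matrix $C_{\mathbf s,f}=\left(\frac{1}{s_i-f\omega_n^j}\right)_{i,j=0}^{n-1}$ is well defined and nonsingular. Then $$\kappa(V_{\mathbf s})\ge \frac{\sqrt n\,\|C_{\mathbf s,f}^{-1}\|}{\max_{0\le i\le n-1}|s_i^n-f^n|}.$$
   Context: $\|\cdot\|$ is the spectral norm, and $\kappa(M)=\|M\|\,\|M^{-1}\|$ for a nonsingular matrix $M$. *)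

(* Defs.v *)
From mathcomp Require Import all_boot all_order all_algebra.
From mathcomp Require Import boolp classical_sets reals trigo.
From mathcomp Require Import complex.

Set Implicit Arguments.
Unset Strict Implicit.
Unset Printing Implicit Defensive.

Import Order.TTheory GRing.Theory Num.Theory.
Local Open Scope classical_set_scope.
Local Open Scope complex_scope.
Local Open Scope ring_scope.

(* Norms and moduli take values in R: [Normc.normc : R[i] -> R] is used
   instead of [`|_|], whose values are complex. *)
Notation normc := ComplexField.Normc.normc.

Section MatrixNorm.
Variable R : realType.

Definition l2norm (n : nat) (x : 'cV[R[i]]_n) : R :=
  Num.sqrt (\sum_(i < n) normc (x i 0) ^+ 2).

(* Operator norm induced by the Euclidean norm. The supremum is over a set that
   contains 0 and is bounded, since the dimension is finite. *)
Definition spectral_norm (m n : nat) (M : 'M[R[i]]_(m, n)) : R :=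
  sup [set l2norm (M *m x) | x in [set x : 'cV[R[i]]_n | l2norm x <= 1]].

(* Meaningful for M \in unitmx only: [invmx M] is M otherwise. *)
Definition cond_number (n : nat) (M : 'M[R[i]]_n) : R :=
  spectral_norm M * spectral_norm (invmx M).

End MatrixNorm.

Section Knots.
Variable R : realType.

(* exp (2 pi sqrt(-1) / n), by Euler's formula *)
Definition omega (n : nat) : R[i] :=
  cos (2 * pi / n%:R) +i* sin (2 * pi / n%:R).

(* The library's [Vandermonde] has the knots along its columns. *)
Definition vandermonde_mx (n : nat) (s : 'rV[R[i]]_n) : 'M[R[i]]_n :=
  (Vandermonde n s)^T.

Definition cauchy_mx (n : nat) (s : 'rV[R[i]]_n) (f : R[i]) : 'M[R[i]]_n :=
  \matrix_(i, j) (s 0 i - f * omega n ^+ j)^-1.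

End Knots.

(* Main.v *)
Require Import Defs.
From mathcomp Require Import all_boot all_order all_algebra.
From mathcomp Require Import boolp classical_sets reals trigo.
From mathcomp Require Import complex.
From mathcomp Require Import ring lra zify.

(* With t_j = f w^j the roots of x^n - f^n, partial fractions of
   x^k / (x^n - f^n) give V = D C Y, where D = diag(s_i^n - f^n) and
   Y = (t_j^(k+1) / (n f^n))_(j,k). Hence C is invertible and
   C^-1 = Y V^-1 D. As sqrt(n) Y is unitary, this yields
   sqrt(n) |C^-1| <= |V^-1| max_i |s_i^n - f^n|; finally |V| >= 1 because the
   first column of V consists of ones. *)

Set Implicit Arguments.
Unset Strict Implicit.
Unset Printing Implicit Defensive.

Import Order.TTheory GRing.Theory Num.Theory.

Local Open Scope ring_scope.

(** * Euclidean norm of complex vectors, and matrices that scale it *)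

Section L2Norm.
Variable R : realType.
Implicit Types (z : R[i]) (m n : nat).

Lemma normc_ge0 z : 0 <= normc z.
Proof. by case: z => a b /=; rewrite sqrtr_ge0. Qed.

Lemma sqr_normcC z : ((normc z) ^+ 2)%:C%C = (z^* * z)%C.
Proof. by rewrite mulrC -sqr_normc rmorphXn. Qed.

Lemma normcX z m : normc (z ^+ m) = normc z ^+ m.
Proof.
elim: m => [|m IHm]; first by rewrite !expr0 ComplexField.Normc.normc1.
by rewrite !exprS ComplexField.Normc.normcM IHm.
Qed.

Lemma normc_nat m : normc (m%:R : R[i]) = m%:R.
Proof.
apply: complexI.
by rewrite [LHS](_ : _ = `|m%:R : R[i]|) // normr_nat raddfMn /=.
Qed.

Lemma l2norm_ge0 n (x : 'cV[R[i]]_n) : 0 <= l2norm x.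
Proof. exact: sqrtr_ge0. Qed.

Lemma sqr_l2norm n (x : 'cV[R[i]]_n) :
  l2norm x ^+ 2 = \sum_(i < n) normc (x i 0) ^+ 2.
Proof. by rewrite sqr_sqrtr // sumr_ge0 // => i _; rewrite exprn_ge0 ?normc_ge0. Qed.

Lemma l2norm0 n : l2norm (0 : 'cV[R[i]]_n) = 0.
Proof.
rewrite /l2norm big1 ?sqrtr0 // => i _.
by rewrite mxE ComplexField.Normc.normc0 expr0n.
Qed.

Lemma normc_le_l2norm n (x : 'cV[R[i]]_n) i : normc (x i 0) <= l2norm x.
Proof.
rewrite -(ler_pXn2r (n := 2)) ?nnegrE ?normc_ge0 ?l2norm_ge0 //.
rewrite sqr_l2norm (bigD1 i) //= lerDl sumr_ge0 // => j _.
by rewrite exprn_ge0 ?normc_ge0.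
Qed.

Lemma l2norm_eq0 n (x : 'cV[R[i]]_n) : l2norm x = 0 -> x = 0.
Proof.
move=> x0; apply/colP => i; rewrite mxE; apply: ComplexField.Normc.eq0_normc.
by apply/eqP; rewrite eq_le normc_ge0 andbT -x0 normc_le_l2norm.
Qed.

(** Each square is one term of the expanded square of the sum. This crude bound serves to show that
    spectral norms are finite. *)
Lemma l2norm_le_sum n (x : 'cV[R[i]]_n) :
  l2norm x <= \sum_(i < n) normc (x i 0).
Proof.
have sum_ge0 : 0 <= \sum_(i < n) normc (x i 0).
  by rewrite sumr_ge0 // => i _; rewrite normc_ge0.
rewrite -(ler_pXn2r (n := 2)) ?nnegrE ?l2norm_ge0 //.
rewrite sqr_l2norm [leRHS]expr2 mulr_suml ler_sum // => i _.
rewrite expr2 ler_wpM2l ?normc_ge0 // (bigD1 i) //= lerDl.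
by rewrite sumr_ge0 // => j _; rewrite normc_ge0.
Qed.

Lemma l2normZ n a (x : 'cV[R[i]]_n) : l2norm (a *: x) = normc a * l2norm x.
Proof.
apply/eqP; rewrite -(eqrXn2 (n := 2)) ?mulr_ge0 ?normc_ge0 ?l2norm_ge0 //.
rewrite exprMn !sqr_l2norm mulr_sumr; apply/eqP; apply: eq_bigr => i _.
by rewrite mxE ComplexField.Normc.normcM exprMn.
Qed.

Lemma l2norm_diag_le n (d : 'rV[R[i]]_n) (b : R) (x : 'cV[R[i]]_n) :
    0 <= b -> (forall i, normc (d 0 i) <= b) ->
  l2norm (diag_mx d *m x) <= b * l2norm x.
Proof.
move=> b0 db; rewrite -(ler_pXn2r (n := 2)) ?nnegrE ?mulr_ge0 ?l2norm_ge0 //.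
rewrite exprMn !sqr_l2norm mulr_sumr ler_sum // => i _.
rewrite mul_diag_mx mxE ComplexField.Normc.normcM exprMn.
rewrite ler_wpM2r ?exprn_ge0 ?normc_ge0 //.
by rewrite ler_pXn2r ?nnegrE ?normc_ge0.
Qed.

Lemma sqr_l2norm_conjmx n (x : 'cV[R[i]]_n) :
  ((l2norm x ^+ 2)%:C%C)%:M = (map_mx conjc x)^T *m x.
Proof.
rewrite sqr_l2norm rmorph_sum; apply/matrixP => i j; rewrite !ord1 !mxE mulr1n.
by apply: eq_bigr => k _; rewrite !mxE -sqr_normcC.
Qed.

(** With [^*] the conjugate transpose, [(W x)^* (W x) = x^* (W^* W) x = a x^* x]. *)
Lemma l2norm_scaled_unitary m n (W : 'M[R[i]]_(m, n)) (a : R) (x : 'cV_n) :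
    0 <= a -> (map_mx conjc W)^T *m W = (a%:C%C)%:M ->
  l2norm (W *m x) = Num.sqrt a * l2norm x.
Proof.
move=> a0 WW; apply/eqP.
rewrite -(eqrXn2 (n := 2)) ?mulr_ge0 ?sqrtr_ge0 ?l2norm_ge0 //.
rewrite exprMn (sqr_sqrtr a0); apply/eqP; apply: complexI.
have := sqr_l2norm_conjmx (W *m x).
rewrite map_mxM trmx_mul mulmxA -[_ *m _ *m W]mulmxA WW -mulmxA mul_scalar_mx.
rewrite -scalemxAr -sqr_l2norm_conjmx => /matrixP/(_ 0 0).
by rewrite !mxE eqxx !mulr1n => ->; rewrite -rmorphM.
Qed.

End L2Norm.

(** * The spectral norm as an operator norm *)

Section SpectralNorm.
Local Open Scope classical_set_scope.
Variable R : realType.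
Variables m n : nat.
Implicit Type M : 'M[R[i]]_(m, n).

(** Coordinates of a vector in the unit ball have modulus at most 1, so the sum of the moduli of all
    entries of [M] is an upper bound. *)
Lemma spectral_norm_has_sup M :
  has_sup [set l2norm (M *m x) | x in [set x : 'cV[R[i]]_n | l2norm x <= 1]].
Proof.
split; first by exists (l2norm (M *m 0)), 0 => //=; rewrite l2norm0 ler01.
exists (\sum_(i < m) \sum_(j < n) normc (M i j)) => _ [x /= x1 <-].
apply: le_trans (l2norm_le_sum _) _; apply: ler_sum => i _; rewrite mxE.
elim/big_ind2 : _ => [|a b c d ab cd|j _].
- by rewrite ComplexField.Normc.normc0.
- by apply: le_trans (le_normcD _ _) _; rewrite lerD.
- rewrite ComplexField.Normc.normcM ler_piMr ?normc_ge0 //.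
  exact: le_trans (normc_le_l2norm _ _) x1.
Qed.

Lemma l2norm_mulmx_le M (x : 'cV[R[i]]_n) :
  l2norm (M *m x) <= spectral_norm M * l2norm x.
Proof.
have [x0|x0] := eqVneq (l2norm x) 0.
  by rewrite (l2norm_eq0 x0) mulmx0 !l2norm0 mulr0.
have xgt0 : 0 < l2norm x by rewrite lt_def x0 l2norm_ge0.
have nC : normc (((l2norm x)^-1)%:C%C) = (l2norm x)^-1.
  by rewrite /= expr0n addr0 sqrtr_sqr ger0_norm // invr_ge0 ltW.
(* Normalizing [x] puts it in the unit ball over which the supremum is taken. *)
rewrite -ler_pdivrMr // mulrC -nC -l2normZ scalemxAr.
apply: sup_upper_bound; first exact: spectral_norm_has_sup.
by exists ((((l2norm x)^-1)%:C)%C *: x) => //=; rewrite l2normZ nC mulVf.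
Qed.

Lemma spectral_norm_le M (b : R) :
    0 <= b -> (forall x, l2norm (M *m x) <= b * l2norm x) ->
  spectral_norm M <= b.
Proof.
move=> b0 Mb; apply: ge_sup; first by case: (spectral_norm_has_sup M).
by move=> _ [x /= x1 <-]; apply: le_trans (Mb x) _; rewrite ler_piMr.
Qed.

Lemma spectral_norm_ge0 M : 0 <= spectral_norm M.
Proof.
apply: le_trans (l2norm_ge0 (M *m 0)) _.
apply: sup_upper_bound; first exact: spectral_norm_has_sup.
by exists 0 => //=; rewrite l2norm0 ler01.
Qed.

End SpectralNorm.

Lemma spectral_norm_vandermonde_ge1 (R : realType) n (s : 'rV[R[i]]_n) :
  (0 < n)%N -> 1 <= spectral_norm (vandermonde_mx s).
Proof.
case: n s => // n s _; pose e : 'cV[R[i]]_n.+1 := delta_mx 0 0.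
have e1 : l2norm e = 1.
  rewrite /l2norm (bigD1 0) //= big1 ?addr0 => [|i i0].
    by rewrite mxE !eqxx ComplexField.Normc.normc1 expr1n sqrtr1.
  by rewrite mxE (negPf i0) mulr0n ComplexField.Normc.normc0 expr0n.
have := l2norm_mulmx_le (vandermonde_mx s) e; rewrite e1 mulr1.
apply: le_trans; apply: le_trans (normc_le_l2norm _ 0).
by rewrite -colE !mxE expr0 ComplexField.Normc.normc1.
Qed.

(** * Primitivity of [omega] *)

Section RootsOfUnity.
Variable R : realType.

Lemma cos_sinX (a : R) k :
  ((cos a +i* sin a) ^+ k)%C = (cos (a *+ k) +i* sin (a *+ k))%C.
Proof.
elim: k => [|k IHk]; first by rewrite mulr0n expr0 cos0 sin0.
rewrite exprS IHk mulrS cosD sinD.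
by congr (_ +i* _)%C; rewrite [RHS]addrC // addrC mulrC [cos a * _]mulrC.
Qed.

Lemma omega_prim n : (0 < n)%N -> n.-primitive_root (omega R n).
Proof.
move=> n0; apply/andP; split=> //; apply/forallP => k; apply/eqP.
have nR : (n%:R : R) != 0 by rewrite pnatr_eq0 -lt0n.
rewrite unity_rootE cos_sinX.
have [->|kn] := eqVneq k.+1 n.
  rewrite -[_ *+ n]mulr_natr divfK // [2 * pi]mulr_natl -[pi *+ 2]add0r.
  by rewrite cosD2pi sinD2pi cos0 sin0 eqxx.
(* Half-angle argument: [cos (2 a) = 1] forces [sin a = 0], while [0 < k.+1 < n] places [a] strictly
   between 0 and [pi], where the sine is positive. *)
apply/negbTE/negP => /eqP[]; pose a : R := pi / n%:R *+ k.+1.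
have -> : 2 * pi / n%:R *+ k.+1 = a *+ 2 :> R.
  by rewrite -mulrA [2 * _]mulr_natl mulrnAC.
rewrite cos_mulr2n cos2sin2 => c1 _.
have sin0 : sin a = 0.
  by apply/eqP; rewrite -sqrf_eq0; apply/eqP; lra.
have /sin_gt0_pi : 0 < a < pi.
  rewrite /a -mulr_natr mulr_gt0 ?divr_gt0 ?pi_gt0 ?ltr0n //=.
  rewrite -mulrA gtr_pMr ?pi_gt0 // mulrC ltr_pdivrMr ?ltr0n // mul1r ltr_nat.
  by rewrite ltn_neqAle kn ltn_ord.
by rewrite sin0 ltxx.
Qed.

End RootsOfUnity.

(** * Power sums over roots of unity, and partial fractions *)

Lemma sum_unity_root_expr (F : fieldType) n (z : F) :
  z ^+ n = 1 -> z != 1 -> \sum_(j < n) z ^+ j = 0.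
Proof.
move=> zn z1; have := subrX1 z n; rewrite zn subrr => /esym/eqP.
by rewrite mulf_eq0 subr_eq0 (negPf z1) => /eqP.
Qed.

(** [w ^+ m] is again an [n]-th root of unity, and equals 1 exactly when [n] divides [m]. *)
Lemma sum_prim_root_expr (F : fieldType) n (w : F) m :
    n.-primitive_root w ->
  \sum_(j < n) (w ^+ m) ^+ j = if (n %| m)%N then n%:R else 0.
Proof.
move=> pw; case: ifPn => nm.
  move: nm; rewrite (prim_order_dvd pw) => /eqP ->.
  by rewrite (eq_bigr (fun=> 1)) => [|j _]; rewrite ?expr1n // sumr_const card_ord.
apply: sum_unity_root_expr; last by rewrite -(prim_order_dvd pw).
by rewrite exprAC (prim_expr_order pw) expr1n.
Qed.

(* Partial-fraction form of Lagrange interpolation of [x ^ k] at the roots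
   [f * w ^ j] of [x ^ n - f ^ n]. *)
Lemma partial_fraction_expr (F : fieldType) n (w f x : F) k :
    (k < n)%N -> n.-primitive_root w -> f != 0 ->
    (forall j : 'I_n, x != f * w ^+ j) ->
  (x ^+ n - f ^+ n) *
    \sum_(j < n) (x - f * w ^+ j)^-1 * ((n%:R * f ^+ n)^-1 * (f * w ^+ j) ^+ k.+1)
  = x ^+ k.
Proof.
move=> kn pw f0 xf.
pose c := (n%:R * f ^+ n)^-1; rewrite mulr_sumr.
(* Each [f * w ^+ j] has [n]-th power [f ^+ n], so dividing [x ^+ n - f ^+ n] by [x - f * w ^+ j]
   leaves a geometric sum. After exchanging sums, the inner sum over [j] is a power sum of roots of
   unity. *)
transitivity (\sum_(j < n) \sum_(i < n) x ^+ (n.-1 - i) * f ^+ (i + k.+1) * c *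
    (w ^+ (i + k.+1)) ^+ j).
  apply: eq_bigr => j _.
  have geom : (x ^+ n - f ^+ n) * (x - f * w ^+ j)^-1 =
      \sum_(i < n) x ^+ (n.-1 - i) * (f * w ^+ j) ^+ i.
    have -> : f ^+ n = (f * w ^+ j) ^+ n.
      by rewrite exprMn exprAC (prim_expr_order pw) expr1n mulr1.
    by rewrite subrXX mulrAC mulfV ?mul1r // subr_eq0.
  rewrite [LHS]mulrA geom mulr_suml; apply: eq_bigr => i _.
  rewrite mulrACA -exprD exprMn [(w ^+ j) ^+ _]exprAC -/c.
  by ring.
rewrite exchange_big /=.
under eq_bigr do rewrite -mulr_sumr (sum_prim_root_expr _ pw).
(* Since [0 < i + k.+1 < 2 n], the only exponent divisible by [n] is [n] itself, reached at
   [i = n.-1 - k]; that term is [x ^+ k]. *)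
have ni : (n.-1 - k < n)%N by lia.
rewrite (bigD1 (Ordinal ni)) //= big1 ?addr0 => [|i /eqP ik].
  have -> : (n.-1 - k + k.+1 = n)%N by lia.
  have -> : (n.-1 - (n.-1 - k) = k)%N by lia.
  by rewrite dvdnn /c; field; rewrite expf_neq0 ?(prim_root_natf_neq0 pw).
case: ifP => [/dvdnP[q qn]|_]; last by rewrite mulr0.
have q1 : q = 1%N by have := ltn_ord i; nia.
by case: ik; apply: val_inj => /=; lia.
Qed.

Theorem theorem4p1 (R : realType) (n : nat) (s : 'rV[R[i]]_n) (f : R[i])
    (hn : (0 < n)%N)
    (hV : vandermonde_mx s \in unitmx)
    (hf : normc f = 1)
    (hsf : forall i j : 'I_n, s 0 i != f * omega R n ^+ j) :
  cauchy_mx s f \in unitmx /\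
  cond_number (vandermonde_mx s) >=
    Num.sqrt n%:R * spectral_norm (invmx (cauchy_mx s f))
      / \big[Num.max/0]_(i < n) normc (s 0 i ^+ n - f ^+ n).
Proof.
have pw := omega_prim R hn.
have neq0_normc1 (z : R[i]) : normc z = 1 -> z != 0.
  move=> z1; apply/eqP => z0; move: z1; rewrite z0 ComplexField.Normc.normc0.
  by move=> /esym/eqP; rewrite oner_eq0.
have f0 := neq0_normc1 _ hf.
pose t (j : 'I_n) := f * omega R n ^+ j.
(* The matrix Y is [c *: W]; keeping the scalar apart lets [W] have Gram matrix [n] times the
   identity. *)
pose W : 'M[R[i]]_n := \matrix_(j, k) t j ^+ k.+1.
pose c : R[i] := (n%:R * f ^+ n)^-1.
pose D : 'rV[R[i]]_n := \row_i (s 0 i ^+ n - f ^+ n).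
set B := \big[Num.max/0]_(i < n) _.
have VE : vandermonde_mx s = diag_mx D *m (cauchy_mx s f *m (c *: W)).
  apply/matrixP => i k; rewrite mul_diag_mx !mxE.
  rewrite -(partial_fraction_expr (ltn_ord k) pw f0 (hsf i)).
  by congr (_ * _); apply: eq_bigr => j _; rewrite !mxE.
have Cinv :
    cauchy_mx s f *m (c *: W *m invmx (vandermonde_mx s) *m diag_mx D) = 1%:M.
  (* For square matrices a one-sided inverse is two-sided, so D may be moved from the left end of
     [D C Y V^-1 = 1] to the right; this bypasses a separate proof that D is invertible. *)
  rewrite !mulmxA; apply: mulmx1C.
  by rewrite !mulmxA -[diag_mx D *m _ *m _]mulmxA -VE mulmxV.
have [Cu _] := mulmx1_unit Cinv; split=> //.
have -> : invmx (cauchy_mx s f) = c *: W *m invmx (vandermonde_mx s) *m diag_mx D.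
  by rewrite -[LHS]mulmx1 -Cinv mulKmx.
have wn1 : normc (omega R n) = 1 by rewrite /omega /= cos2Dsin2 sqrtr1.
have tn1 j : normc (t j) = 1.
  by rewrite ComplexField.Normc.normcM hf normcX wn1 expr1n mulr1.
have w0 := neq0_normc1 _ wn1; have t0 j := neq0_normc1 _ (tn1 j).
have WW : (map_mx conjc W)^T *m W = ((n%:R : R)%:C%C)%:M.
  have tJ j : conjc (t j) = (t j)^-1.
    apply: (mulIf (t0 j)); rewrite mulVf //.
    by rewrite -sqr_normcC tn1 expr1n.
  (* As [t j] has modulus 1, the product is [t j] to the power [l - k], possibly negative and hence
     written with quotients. Summing over [j] leaves a geometric sum of ratio
     [omega R n ^+ l / omega R n ^+ k]. *)
  have W_kl k l j : conjc (t j ^+ k.+1) * t j ^+ l.+1 =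
      f ^+ l / f ^+ k * (omega R n ^+ l / omega R n ^+ k) ^+ j.
    rewrite rmorphXn /= tJ exprVn !exprS invfM.
    rewrite mulrACA mulVf // mul1r /t !exprMn invfM exprVn.
    rewrite ![omega R n ^+ j ^+ _]exprAC.
    by ring.
  apply/matrixP => k l; rewrite !mxE.
  under eq_bigr do rewrite !mxE W_kl.
  rewrite -mulr_sumr; have [<-|kl] := eqVneq k l.
    rewrite !divff ?expf_neq0 // mul1r.
    by under eq_bigr do rewrite expr1n; rewrite sumr_const card_ord rmorph_nat.
  rewrite sum_unity_root_expr ?mulr0 //.
    by rewrite exprMn exprVn -!exprM ![(_ * n)%N]mulnC !exprM
      (prim_expr_order pw) !expr1n divr1.
  (* A ratio equal to 1 means that [k] and [l] agree modulo [n]; both are below [n], so they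
     coincide. *)
  apply: contraNneq kl => /divr1_eq/eqP.
  by rewrite (eq_prim_root_expr pw) !modn_small // eq_sym => /eqP/val_inj ->.
have B0 : 0 <= B by exact: bigmax_ge_id.
have DB i : normc (D 0 i) <= B.
  by rewrite mxE; apply: (le_bigmax _ (fun i => normc (s 0 i ^+ n - f ^+ n))).
(* [c] has modulus [1 / n] because [f] has modulus 1, and [W] scales lengths by [sqrt n]. *)
have normW x : l2norm (c *: W *m x) = (Num.sqrt n%:R)^-1 * l2norm x.
  rewrite -scalemxAl l2normZ (l2norm_scaled_unitary _ _ WW) ?ler0n // mulrA.
  rewrite ComplexField.Normc.normcV ComplexField.Normc.normcM normcX hf expr1n.
  rewrite mulr1 normc_nat -{1}[n%:R]sqr_sqrtr ?ler0n //; congr (_ * _).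
  by rewrite expr2 invfM mulfVK // sqrtr_eq0 -ltNge ltr0n.
have sqn : Num.sqrt n%:R != 0 :> R by rewrite sqrtr_eq0 -ltNge ltr0n.
have sqn0 : 0 <= (Num.sqrt n%:R)^-1 :> R by rewrite invr_ge0 sqrtr_ge0.
set X := _ *m _ *m diag_mx D; set K := spectral_norm (invmx (vandermonde_mx s)).
have K0 : 0 <= K := spectral_norm_ge0 _.
have normX : spectral_norm X <= (Num.sqrt n%:R)^-1 * (K * B).
  apply: spectral_norm_le => [|x]; first by rewrite !mulr_ge0.
  rewrite /X -!mulmxA normW -!mulrA ler_wpM2l //.
  apply: le_trans (l2norm_mulmx_le _ _) _; rewrite ler_wpM2l //.
  exact: l2norm_diag_le.
(* [K] lies between the two sides: it is at most the condition number because the norm of V is at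
   least 1. *)
apply: (@le_trans _ _ K); last first.
  by rewrite -[leLHS]mul1r ler_wpM2r // spectral_norm_vandermonde_ge1.
(* B = 0 cannot occur, but x / 0 = 0 makes that case trivial. *)
have [->|Bn0] := eqVneq B 0; first by rewrite invr0 mulr0.
have Bgt0 : 0 < B by rewrite lt_def Bn0.
rewrite ler_pdivrMr // -[leRHS](mulVKf sqn) ler_wpM2l ?sqrtr_ge0 //.
Qed.
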